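(* Let $(M,J,g)$ be a locally conformal Kähler manifold with Lee vector field $B$, and let $K\subset M$ be a complex submanifold of complex dimension $m$. Then $K$ is a $V$-minimal submanifold of $M$ for the vector field $V=-mB$.
   Context: Locally conformal Kähler (l.c.K.) manifold: a Hermitian manifold $(M,J,g)$ (with $J$ an integrable complex structure and $g$ a Hermitian metric) admitting an open cover $\{U_i\}_{i\in I}$ and smooth functions $f_i:U_i\to\mathbb{R}$ such that each local metric $g_i=\exp(-f_i)\,g|_{U_i}$ is Kähler. Let $\Omega(X,Y)=g(X,JY)$. On an l.c.K. manifold there is a globally defined closed 1-form $\omega$, the Lee form, with $d\Omega=\omega\wedge\Omega$; it satisfies $\omega|_{U_i}=df_i$. The Lee vector field $B=\omega^\sharp$ is defined by $\omega(X)=g(X,B)$ for all $X$. $V$-minimality: let $K$ be a submanifold of a Riemannian manifold $(M,g)$ and let $V$ be a smooth vector field on $M$. The second fundamental form $A:TK\times TK\to TK^\perp$ is defined by $\nabla^M_XY=\nabla^K_XY+A(X,Y)$ for $X,Y\in\Gamma(TK)$, where $\nabla^M,\nabla^K$ are the Levi-Civita connections of $M$ and of $K$ with the induced metric. Its trace is not normalized: $\mathrm{trace}(A)=\sum_j A(e_j,e_j)$ over a local orthonormal frame $\{e_j\}$ of the real tangent bundle $TK$. The submanifold $K$ is called $V$-minimal if $\mathrm{trace}(A)-V$ (with $V$ restricted to $K$) is tangent to $K$ at every point of $K$, equivalently $\mathrm{trace}(A)-V^\perp=0$, where $V^\perp$ is the component of $V|_K$ normal to $K$. *)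

(* Defs.v *)
From HB Require Import structures.
From mathcomp Require Import all_boot all_order all_algebra.
From mathcomp Require Import all_classical all_reals all_analysis.
Set Implicit Arguments.
Unset Strict Implicit.
Unset Printing Implicit Defensive.
Import Order.TTheory GRing.Theory Num.Theory.
Import numFieldNormedType.Exports.
Local Open Scope classical_set_scope.
Local Open Scope ring_scope.

(* Classical tensor calculus on smooth manifolds.  Tensor fields are families of
   component functions, one per chart of an atlas, related by the usual
   transformation laws.  Tangent vectors are row vectors, so linear maps act on
   the right: v |-> v *m A, in agreement with 'J f x, for which v *m 'J f x is
   the differential of f at x applied to v.  Component functions are total;
   their values outside the image of the chart are irrelevant. *)

Definition partial (R : realType) (n : nat) (V : normedModType R) (i : 'I_n)
    (f : 'rV[R]_n -> V) (x : 'rV[R]_n) : V :=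
  'D_(delta_mx 0 i) f x.

(* meaningful for open U *)
Fixpoint Ck_on (R : realType) (n : nat) (V : normedModType R) (k : nat)
    (U : set 'rV[R]_n) (f : 'rV[R]_n -> V) : Prop :=
  match k with
  | 0 => forall x, U x -> {for x, continuous f}
  | k'.+1 => (forall x, U x -> differentiable f x) /\
             (forall i : 'I_n, Ck_on k' U (partial i f))
  end.

Definition smooth_on (R : realType) (n : nat) (V : normedModType R)
    (U : set 'rV[R]_n) (f : 'rV[R]_n -> V) : Prop :=
  forall k, Ck_on k U f.

Record chart (R : realType) (n : nat) (T : topologicalType) := Chart {
  dom : set T;
  coord : T -> 'rV[R]_n;
  param : 'rV[R]_n -> T;
  dom_open : open dom;
  image_open : open (coord @` dom);
  coordK : forall p, dom p -> param (coord p) = p;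
  coord_continuous : forall p, dom p -> {for p, continuous coord};
  param_continuous : forall x, (coord @` dom) x -> {for x, continuous param}
}.

Definition transition (R : realType) (n : nat) (T : topologicalType)
    (c d : chart R n T) : 'rV[R]_n -> 'rV[R]_n :=
  coord d \o param c.

Record manifold (R : realType) (n : nat) := Manifold {
  carrier :> topologicalType;
  index : Type;
  atlas : index -> chart R n carrier;
  atlas_cover : forall p : carrier, exists c, dom (atlas c) p;
  atlas_smooth : forall c d,
    smooth_on (coord (atlas c) @` (dom (atlas c) `&` dom (atlas d)))
      (transition (atlas c) (atlas d));
  manifold_hausdorff : hausdorff_space carrier;
  manifold_second_countable : @second_countable carrier
}.

(* the image in coordinate space of the part of W covered by the chart c *)
Definition cimage (R : realType) (n : nat) (M : manifold R n) (c : index M)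
    (W : set M) : set 'rV[R]_n :=
  coord (atlas c) @` (dom (atlas c) `&` W).

Definition smooth_fun_on (R : realType) (n : nat) (M : manifold R n)
    (W : set M) (f : M -> R) : Prop :=
  forall c : index M, smooth_on (cimage c W) (f \o param (atlas c) : _ -> R^o).

Definition components (R : realType) (n : nat) (M : manifold R n) (V : Type) :=
  index M -> 'rV[R]_n -> V.

(* tr D v v' : the components v in a chart c and v' in a chart d represent the
   same tensor, D being the Jacobian of the transition map from c to d *)
Definition tensor_field_on (R : realType) (n : nat) (M : manifold R n)
    (V : normedModType R) (tr : 'M[R]_n -> V -> V -> Prop) (W : set M)
    (A : components M V) : Prop :=
  (forall c, smooth_on (cimage c W) (A c)) /\
  (forall c d x, cimage c (dom (atlas d) `&` W) x ->
     let tau := transition (atlas c) (atlas d) in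
     tr ('J tau x) (A c x) (A d (tau x))).

Definition vector_field_on (R : realType) (n : nat) (M : manifold R n) :
    set M -> components M 'rV[R]_n -> Prop :=
  tensor_field_on (fun D v v' => v' = v *m D).

Definition one_form_on (R : realType) (n : nat) (M : manifold R n) :
    set M -> components M 'rV[R]_n -> Prop :=
  tensor_field_on (fun D w w' => w = w' *m D^T).

Definition bilinear_field_on (R : realType) (n : nat) (M : manifold R n) :
    set M -> components M 'M[R]_n -> Prop :=
  tensor_field_on (fun D b b' => b = D *m b' *m D^T).

Definition endo_field_on (R : realType) (n : nat) (M : manifold R n) :
    set M -> components M 'M[R]_n -> Prop :=
  tensor_field_on (fun D A A' => A *m D = D *m A').

(* dext1, dext2 and wedge12 follow the convention in which
   dw(X, Y) = X w(Y) - Y w(X) - w([X, Y]) and w /\ b is the cyclic sum of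
   w(X) b(Y, Z), without numerical factors.  A 2-form is given by its (skew)
   matrix of components. *)
Definition dext1 (R : realType) (n : nat) (w : 'rV[R]_n -> 'rV[R]_n)
    (x : 'rV[R]_n) (i j : 'I_n) : R :=
  partial i (fun y => w y 0 j : R^o) x - partial j (fun y => w y 0 i : R^o) x.

Definition dext2 (R : realType) (n : nat) (b : 'rV[R]_n -> 'M[R]_n)
    (x : 'rV[R]_n) (i j k : 'I_n) : R :=
  partial i (fun y => b y j k : R^o) x + partial j (fun y => b y k i : R^o) x
  + partial k (fun y => b y i j : R^o) x.

Definition wedge12 (R : realType) (n : nat) (w : 'rV[R]_n) (b : 'M[R]_n)
    (i j k : 'I_n) : R :=
  w 0 i * b j k + w 0 j * b k i + w 0 k * b i j.

Definition pairing (R : realType) (n : nat) (b : 'M[R]_n) (u v : 'rV[R]_n) : R :=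
  (u *m b *m v^T) 0 0.

Definition riemannian_metric_on (R : realType) (n : nat) (M : manifold R n)
    (W : set M) (g : components M 'M[R]_n) : Prop :=
  bilinear_field_on W g /\
  (forall c x, cimage c W x ->
     (forall u v, pairing (g c x) u v = pairing (g c x) v u) /\
     (forall v, v != 0 -> 0 < pairing (g c x) v v)).

Definition lie_bracket (R : realType) (n : nat) (X Y : 'rV[R]_n -> 'rV[R]_n)
    (x : 'rV[R]_n) : 'rV[R]_n :=
  'D_(X x) Y x - 'D_(Y x) X x.

(* G c i j x : components in the chart c of the covariant derivative of the
   j-th coordinate field along the i-th one *)
Definition christoffel (R : realType) (n : nat) (M : manifold R n) :=
  index M -> 'I_n -> 'I_n -> 'rV[R]_n -> 'rV[R]_n.

Definition christoffel_term (R : realType) (n : nat) (M : manifold R n)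
    (G : christoffel M) (c : index M) (x u v : 'rV[R]_n) : 'rV[R]_n :=
  \sum_(i < n) \sum_(j < n) (u 0 i * v 0 j) *: G c i j x.

Definition nabla (R : realType) (n : nat) (M : manifold R n) (G : christoffel M)
    (c : index M) (X Y : 'rV[R]_n -> 'rV[R]_n) (x : 'rV[R]_n) : 'rV[R]_n :=
  'D_(X x) Y x + christoffel_term G c x (X x) (Y x).

Definition affine_connection (R : realType) (n : nat) (M : manifold R n)
    (G : christoffel M) : Prop :=
  forall (W : set M) (X Y : components M 'rV[R]_n), open W ->
    vector_field_on W X -> vector_field_on W Y ->
    vector_field_on W (fun c => nabla G c (X c) (Y c)).

(* A vector field on the domain of a chart c is the same thing as a smooth map
   on the image of c; torsion-freeness and metricity are local, hence
   are expressed with such fields. *)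
Definition levi_civita (R : realType) (n : nat) (M : manifold R n)
    (g : components M 'M[R]_n) (G : christoffel M) : Prop :=
  [/\ affine_connection G,
      forall c X Y, smooth_on (cimage c setT) X -> smooth_on (cimage c setT) Y ->
        forall x, cimage c setT x ->
        nabla G c X Y x - nabla G c Y X x = lie_bracket X Y x
    & forall c X Y Z, smooth_on (cimage c setT) X ->
        smooth_on (cimage c setT) Y -> smooth_on (cimage c setT) Z ->
        forall x, cimage c setT x ->
        'D_(X x) (fun y => pairing (g c y) (Y y) (Z y) : R^o) x =
        pairing (g c x) (nabla G c X Y x) (Z x) +
        pairing (g c x) (Y x) (nabla G c X Z x)].

Definition almost_complex (R : realType) (n : nat) (M : manifold R n)
    (J : components M 'M[R]_n) : Prop :=
  endo_field_on setT J /\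
  (forall c x, cimage c setT x -> J c x *m J c x = - 1%:M).

(* J here is a (1,1)-tensor with J^2 = -1, whence the term - [X, Y] *)
Definition nijenhuis (R : realType) (n : nat) (J : 'rV[R]_n -> 'M[R]_n)
    (X Y : 'rV[R]_n -> 'rV[R]_n) (x : 'rV[R]_n) : 'rV[R]_n :=
  let JX y := X y *m J y in
  let JY y := Y y *m J y in
  lie_bracket JX JY x - lie_bracket JX Y x *m J x - lie_bracket X JY x *m J x
  - lie_bracket X Y x.

Definition integrable (R : realType) (n : nat) (M : manifold R n)
    (J : components M 'M[R]_n) : Prop :=
  forall c X Y, smooth_on (cimage c setT) X -> smooth_on (cimage c setT) Y ->
    forall x, cimage c setT x -> nijenhuis (J c) X Y x = 0.

Definition complex_structure (R : realType) (n : nat) (M : manifold R n)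
    (J : components M 'M[R]_n) : Prop :=
  almost_complex J /\ integrable J.

Definition hermitian_metric_on (R : realType) (n : nat) (M : manifold R n)
    (W : set M) (J g : components M 'M[R]_n) : Prop :=
  riemannian_metric_on W g /\
  (forall c x, cimage c W x -> forall u v,
     pairing (g c x) (u *m J c x) (v *m J c x) = pairing (g c x) u v).

(* matrix of Omega(X, Y) = g(X, JY) *)
Definition fundamental_form (R : realType) (n : nat) (M : manifold R n)
    (J g : components M 'M[R]_n) : components M 'M[R]_n :=
  fun c x => g c x *m (J c x)^T.

Definition kaehler_metric_on (R : realType) (n : nat) (M : manifold R n)
    (W : set M) (J g : components M 'M[R]_n) : Prop :=
  hermitian_metric_on W J g /\
  (forall c x, cimage c W x -> forall i j k,
     dext2 (fundamental_form J g c) x i j k = 0).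

Definition hermitian_manifold (R : realType) (n : nat) (M : manifold R n)
    (J g : components M 'M[R]_n) : Prop :=
  complex_structure J /\ hermitian_metric_on setT J g.

Definition lck_manifold (R : realType) (n : nat) (M : manifold R n)
    (J g : components M 'M[R]_n) : Prop :=
  hermitian_manifold J g /\
  exists (I : Type) (U : I -> set M) (f : I -> M -> R),
    [/\ forall i, open (U i),
        \bigcup_i U i = setT,
        forall i, smooth_fun_on (U i) (f i)
      & forall i, kaehler_metric_on (U i) J
          (fun c x => expR (- f i (param (atlas c) x)) *: g c x)].

Definition lee_form (R : realType) (n : nat) (M : manifold R n)
    (J g : components M 'M[R]_n) (w : components M 'rV[R]_n) : Prop :=
  [/\ one_form_on setT w,
      forall c x, cimage c setT x -> forall i j, dext1 (w c) x i j = 0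
    & forall c x, cimage c setT x -> forall i j k,
        dext2 (fundamental_form J g c) x i j k =
        wedge12 (w c x) (fundamental_form J g c x) i j k].

Definition sharp_of (R : realType) (n : nat) (M : manifold R n)
    (g : components M 'M[R]_n) (w B : components M 'rV[R]_n) : Prop :=
  vector_field_on setT B /\
  (forall c x, cimage c setT x -> forall u : 'rV[R]_n,
     (u *m (w c x)^T) 0 0 = pairing (g c x) u (B c x)).

Section Submanifold.
Context (R : realType) (k n : nat) (K : manifold R k) (M : manifold R n).
Implicit Types (phi : K -> M) (a : index K) (c : index M).

Definition local_expr phi a c : 'rV[R]_k -> 'rV[R]_n :=
  coord (atlas c) \o phi \o param (atlas a).

Definition local_dom phi a c : set 'rV[R]_k :=
  cimage a (phi @^-1` dom (atlas c)).

Definition smooth_map phi : Prop :=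
  continuous phi /\
  forall a c, smooth_on (local_dom phi a c) (local_expr phi a c).

(* injective immersions; embedded submanifolds are a particular case *)
Definition submanifold phi : Prop :=
  [/\ smooth_map phi, injective phi
    & forall a c y, local_dom phi a c y -> row_free ('J (local_expr phi a c) y)].

Definition holomorphic (JK : components K 'M[R]_k) (J : components M 'M[R]_n)
    phi : Prop :=
  forall a c y, local_dom phi a c y ->
    let F := local_expr phi a c in
    JK a y *m 'J F y = 'J F y *m J c (F y).

Definition complex_submanifold (JK : components K 'M[R]_k)
    (J : components M 'M[R]_n) phi : Prop :=
  [/\ complex_structure JK, submanifold phi & holomorphic JK J phi].

Definition induced_metric phi (g : components M 'M[R]_n)
    (gK : components K 'M[R]_k) : Prop :=
  forall a c y, local_dom phi a c y ->
    let F := local_expr phi a c in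
    gK a y = 'J F y *m g c (F y) *m ('J F y)^T.

(* covariant derivative, for the connection GM, of the field dphi(Y) along phi *)
Definition nabla_along phi (GM : christoffel M) a c
    (X Y : 'rV[R]_k -> 'rV[R]_k) (y : 'rV[R]_k) : 'rV[R]_n :=
  let F := local_expr phi a c in
  let dF Z z := Z z *m 'J F z in
  'D_(X y) (dF Y) y + christoffel_term GM c (F y) (dF X y) (dF Y y).

Definition second_fundamental_form phi (GM : christoffel M) (GK : christoffel K)
    a c (X Y : 'rV[R]_k -> 'rV[R]_k) (y : 'rV[R]_k) : 'rV[R]_n :=
  nabla_along phi GM a c X Y y
  - nabla GK a X Y y *m 'J (local_expr phi a c) y.

Definition orthonormal_frame_on (gK : components K 'M[R]_k) (W : set K)
    (E : 'I_k -> components K 'rV[R]_k) : Prop :=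
  (forall j, vector_field_on W (E j)) /\
  (forall a y, cimage a W y -> forall i j,
     pairing (gK a y) (E i a y) (E j a y) = (i == j)%:R).

(* Here gK is the induced metric and GM, GK are the Levi-Civita connections, all
   of which exist and are unique; likewise the trace does not depend on the
   local orthonormal frame E. *)
Definition V_minimal phi (g : components M 'M[R]_n) (V : components M 'rV[R]_n) :
    Prop :=
  forall (gK : components K 'M[R]_k) (GM : christoffel M) (GK : christoffel K),
  induced_metric phi g gK -> levi_civita g GM -> levi_civita gK GK ->
  forall (p : K) (W : set K) (E : 'I_k -> components K 'rV[R]_k),
  open W -> W p -> orthonormal_frame_on gK W E ->
  forall a c, dom (atlas a) p -> dom (atlas c) (phi p) ->
  let y := coord (atlas a) p in
  let trA := \sum_(j < k)
    second_fundamental_form phi GM GK a c (E j a) (E j a) y in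
  exists t : 'rV[R]_k,
    trA - V c (coord (atlas c) (phi p)) = t *m 'J (local_expr phi a c) y.

End Submanifold.

(* Main.v *)
Require Import Defs.
From HB Require Import structures.
From mathcomp Require Import all_boot all_order all_algebra.
From mathcomp Require Import all_classical all_reals all_analysis.
From mathcomp Require Import ring lra.
Set Implicit Arguments.
Unset Strict Implicit.
Unset Printing Implicit Defensive.
Import Order.TTheory GRing.Theory Num.Theory.
Import numFieldNormedType.Exports.
Local Open Scope classical_set_scope.
Local Open Scope ring_scope.

(* For a field X tangent to K and a vector xi normal to K, the Levi-Civita
   axioms give
     g(nabla_X X + nabla_JX JX, xi) = dOmega(X, JX, xi) + g([X, JX], J xi).
   The last term vanishes because [X, JX] is tangent and J xi is normal to K,
   and dOmega = w /\ Omega turns the first one into - g(X, X) w(xi).  Since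
   (J e_j) is an orthonormal frame whenever (e_j) is, summing over a frame yields
   2 g(trace A, xi) = - 2m w(xi) = - 2m g(B, xi).
   In coordinates, the tangency of [X, JX] amounts to the symmetry of the second
   derivatives of the local expression of phi. *)

(** * Directional derivatives of matrix-valued maps *)

Lemma is_derive_mxP (R : realFieldType) (V : normedModType R) m n
    (A : V -> 'M[R]_(m, n)) (x v : V) (dA : 'M[R]_(m, n)) :
  is_derive x v A dA <->
  forall i j, is_derive x v (fun y => A y i j : R^o) (dA i j).
Proof.
split=> [[Ad <-] i j|Ad].
  split; first by move/derivable_mxP : Ad; exact.
  by rewrite derive_mx// mxE.
have Av : derivable A x v by apply/derivable_mxP => i j; exact: ex_derive.
split=> //; rewrite derive_mx//.
by apply/matrixP => i j; rewrite mxE; apply: (@derive_val _ _ _ _ _ _ _ (Ad i j)).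
Qed.

Lemma is_derive_trmx (R : realFieldType) (V : normedModType R) m n
    (A : V -> 'M[R]_(m, n)) (x v : V) dA :
  is_derive x v A dA -> is_derive x v (fun y => (A y)^T) dA^T.
Proof.
move=> /is_derive_mxP Ad; apply/is_derive_mxP => i j.
by rewrite mxE; under eq_fun do rewrite mxE; exact: Ad.
Qed.

Lemma is_derive_mulmx (R : realFieldType) (V : normedModType R) m n p
    (A : V -> 'M[R]_(m, n)) (B : V -> 'M[R]_(n, p)) (x v : V) dA dB :
  is_derive x v A dA -> is_derive x v B dB ->
  is_derive x v (fun y => A y *m B y) (dA *m B x + A x *m dB).
Proof.
move=> /is_derive_mxP Ad /is_derive_mxP Bd; apply/is_derive_mxP => i j.
pose h (k : 'I_n) : V -> R^o := (fun y => A y i k : R^o) * (fun y => B y k j : R^o).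
rewrite [X in is_derive _ _ X _](_ : _ = \sum_(k < n) h k); last first.
  by apply/funext => y; rewrite mxE fct_sumE.
have hd k : is_derive x v (h k) _ := is_deriveM (Ad i k) (Bd k j).
apply: is_derive_eq (is_derive_sum hd) _.
rewrite !mxE -big_split/=; apply: eq_bigr => k _.
by rewrite addrC; congr (_ + _); exact: mulrC.
Qed.

(** The two difference quotients are the same function of the increment. *)
Lemma is_derive_line (R : numFieldType) (V W : normedModType R) (f : V -> W)
    (x u : V) (s : R) (df : W) :
  is_derive (s *: u + x) u f df -> is_derive s 1 (fun t : R => f (t *: u + x)) df.
Proof.
have E : (fun h : R => h^-1 *: (((fun t : R => f (t *: u + x)) \o shift s) (h *: 1)
      - f (s *: u + x))) =
    (fun h => h^-1 *: ((f \o shift (s *: u + x)) (h *: u) - f (s *: u + x))).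
  by apply/funext => h /=; rewrite [h%:A]mulr1 scalerDl addrA.
by move=> [fd <-]; split; rewrite /derivable/derive E.
Qed.

(** * Symmetry of second derivatives *)

Section second_difference.
Context (R : realType) (V : normedModType R).

(** The mean value theorem along [u] turns the second difference into [t] times an increment of [g]
    along [t *: v], and the first-order expansion of [g] at [x] gives the limit. The quotient is
    symmetric in [u] and [v], which yields [derive_comm]. *)
Lemma second_difference_cvg (f g : V -> R^o) (x u v : V) :
  (\forall z \near x, is_derive z u f (g z)) -> differentiable g x ->
  (f (x + t *: u + t *: v) - f (x + t *: u) - f (x + t *: v) + f x) / t ^+ 2
    @[t --> 0^'+] --> 'D_v g x.
Proof.
move=> df dg; rewrite deriveE//.
apply/cvgrPdist_le => e e0.
(* The two remainders below add up to at most [e / C] times [t * (|u| + |v|) + t * |u|]; the summand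
   1 keeps [C] positive. *)
pose C := `|u| + `|u| + `|v| + 1.
have C0 : 0 < C by rewrite ltr_wpDl ?addr_ge0.
have eC0 : 0 < e / C by rewrite divr_gt0.
have [r r0 Hr] : exists2 r : R, 0 < r & forall h : V, `|h| < r ->
    is_derive (x + h) u f (g (x + h)) /\ `|g (x + h) - g x - 'd g x h| <= e / C * `|h|.
  have /diff_locallyx dgx := dg.
  have : \forall h \near (0 : V),
      `|g (h + x) - g x - 'd g x h| <= e / C * `|h|.
    have cancel (a b c : R) : a + b + c - a - b = c by ring.
    near=> h; rewrite dgx cancel.
    by near: h; apply: littleoP.
  have : \forall h \near (0 : V), is_derive (h + x) u f (g (h + x)).
    by move: df; rewrite (near_shift 0 x); apply: filterS => z; rewrite /= subr0.
  move=> /nbhs_ballP[r1 r10 H1] /nbhs_ballP[r2 r20 H2].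
  exists (Num.min r1 r2); first by rewrite lt_min r10.
  move=> h; rewrite lt_min => /andP[h1 h2]; rewrite [x + h]addrC.
  by split; [apply: H1|apply: H2]; rewrite -ball_normE/= sub0r normrN.
near=> t.
have t0 : 0 < t by near: t; exact: nbhs_right_gt.
have tr : t * C < r.
  rewrite -ltr_pdivlMr//; near: t; apply: nbhs_right_lt; exact: divr_gt0.
have small (s b : R) : 0 <= s <= t -> 0 <= b <= t ->
    `|s *: u + b *: v| <= t * (`|u| + `|v|).
  move=> /andP[s0 st] /andP[b0 bt]; rewrite (le_trans (ler_normD _ _))//.
  by rewrite !normrZ !ger0_norm// mulrDr lerD// ler_wpM2r.
have smallr (s b : R) : 0 <= s <= t -> 0 <= b <= t -> `|s *: u + b *: v| < r.
  move=> hs hb; rewrite (le_lt_trans (small _ _ hs hb))// (le_lt_trans _ tr)//.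
  rewrite ler_wpM2l ?(ltW t0)// /C; have := normr_ge0 u; lra.
(* The term [0 *: v] is kept so that [smallr] and [dline] serve both [b = t] and [b = 0]. *)
pose phi (s : R) : R := f (x + (s *: u + t *: v)) - f (x + (s *: u + 0 *: v)).
pose dphi (s : R) : R := g (x + (s *: u + t *: v)) - g (x + (s *: u + 0 *: v)).
have tt : 0 <= t <= t by rewrite lexx ltW.
have t00 : 0 <= (0:R) <= t by rewrite lexx ltW.
have dline (s b : R) : 0 <= s <= t -> 0 <= b <= t ->
    is_derive s 1 (fun s => f (x + (s *: u + b *: v)) : R^o)
      (g (x + (s *: u + b *: v))).
  move=> hs hb; have [dfs _] := Hr _ (smallr _ _ hs hb).
  have /is_derive_line : is_derive (s *: u + (x + b *: v)) u f
      (g (x + (s *: u + b *: v))).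
    by rewrite addrCA.
  by under eq_fun do rewrite addrCA.
have phid (s : R) : 0 <= s <= t -> is_derive s 1 (phi : R -> R^o) (dphi s).
  by move=> hs; apply: is_deriveB; apply: dline.
have [||c /[!in_itv]/= /andP[c0 ct] Hc] := @MVT _ phi dphi 0 t t0.
- by move=> s /[!in_itv]/= /andP[s0 st]; apply: phid; rewrite !ltW.
- apply: derivable_within_continuous => s /[!in_itv]/= hs.
  by have [] := phid s hs.
have hc : 0 <= c <= t by rewrite !ltW.
have -> : f (x + t *: u + t *: v) - f (x + t *: u) - f (x + t *: v) + f x
    = dphi c * t.
  move: Hc; rewrite subr0 => <-; rewrite /phi !scale0r !addr0 add0r.
  by rewrite addrA; ring.
rewrite expr2 -mulf_div divff ?gt_eqF// mulr1.
have [_ g1] := Hr _ (smallr _ _ hc tt).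
have [_ g2] := Hr _ (smallr _ _ hc t00).
have L : 'd g x (c *: u + t *: v) = 'd g x (c *: u + 0 *: v) + t * 'd g x v.
  by rewrite scale0r addr0 linearD [_ (t *: v)]linearZ.
have b1 : `|c *: u + t *: v| <= t * (`|u| + `|v|) by exact: small.
have b2 : `|c *: u + 0 *: v| <= t * `|u|.
  by rewrite scale0r addr0 normrZ gtr0_norm// ler_wpM2r// ltW.
rewrite -(ler_pM2r t0) -[X in _ * X <= _](gtr0_norm t0) -normrM mulrBl divfK ?gt_eqF//.
have {g1}g1 := le_trans g1 (ler_wpM2l (ltW eC0) b1).
have {g2}g2 := le_trans g2 (ler_wpM2l (ltW eC0) b2).
(* Up to sign, the error is a difference of two first-order remainders of [g] at [x], whose linear
   parts differ by [t * 'd g x v]. *)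
have -> : 'd g x v * t - dphi c =
   - ((g (x + (c *: u + t *: v)) - g x - 'd g x (c *: u + t *: v))
   - (g (x + (c *: u + 0 *: v)) - g x - 'd g x (c *: u + 0 *: v))).
  by rewrite L /dphi; ring.
rewrite normrN (le_trans (ler_normB _ _))// (le_trans (lerD g1 g2))//.
have -> : e * t = e / C * (t * C) by rewrite mulrCA divfK ?gt_eqF// mulrC.
rewrite -mulrDr ler_wpM2l// ?(ltW eC0)// -mulrDr ler_wpM2l ?(ltW t0)//.
by rewrite /C; lra.
Unshelve. all: by end_near. Qed.

Lemma derive_comm (f g h : V -> R^o) (x u v : V) :
  (\forall z \near x, is_derive z u f (g z)) -> differentiable g x ->
  (\forall z \near x, is_derive z v f (h z)) -> differentiable h x ->
  'D_v g x = 'D_u h x.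
Proof.
move=> fg dg fh dh; have := second_difference_cvg fh dh (v := u).
rewrite (_ : (fun t => _) = fun t => (f (x + t *: u + t *: v) - f (x + t *: u)
    - f (x + t *: v) + f x) / t ^+ 2); last first.
  by apply/funext => t; rewrite [x + _ + _]addrAC; congr (_ / _); ring.
exact: (cvg_unique _ (second_difference_cvg fg dg)).
Qed.

End second_difference.

(** * Bilinear forms and orthogonality in matrix form *)

Section pairing_theory.
Context (R : realType) (n : nat).
Implicit Types (b G J : 'M[R]_n) (u v : 'rV[R]_n).

Lemma pairingDl b u u' v : pairing b (u + u') v = pairing b u v + pairing b u' v.
Proof. by rewrite /pairing !mulmxDl mxE. Qed.

Lemma pairingDr b u v v' : pairing b u (v + v') = pairing b u v + pairing b u v'.
Proof. by rewrite /pairing linearD mulmxDr mxE. Qed.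

Lemma pairingZl b a u v : pairing b (a *: u) v = a * pairing b u v.
Proof. by rewrite /pairing -!scalemxAl mxE. Qed.

Lemma pairingZr b a u v : pairing b u (a *: v) = a * pairing b u v.
Proof. by rewrite /pairing linearZ -scalemxAr mxE. Qed.

Lemma pairingNl b u v : pairing b (- u) v = - pairing b u v.
Proof. by rewrite -scaleN1r pairingZl mulN1r. Qed.

Lemma pairingNr b u v : pairing b u (- v) = - pairing b u v.
Proof. by rewrite -scaleN1r pairingZr mulN1r. Qed.

Lemma pairingBl b u u' v : pairing b (u - u') v = pairing b u v - pairing b u' v.
Proof. by rewrite pairingDl pairingNl. Qed.

Lemma pairing_suml (I : finType) b (F : I -> 'rV[R]_n) v :
  pairing b (\sum_i F i) v = \sum_i pairing b (F i) v.
Proof. by rewrite /pairing !mulmx_suml summxE. Qed.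

Lemma pairing_delta b i j : pairing b (delta_mx 0 i) (delta_mx 0 j) = b i j.
Proof. by rewrite /pairing -rowE trmx_delta -colE !mxE. Qed.

Lemma pairing_trmx b u v : pairing b^T u v = pairing b v u.
Proof.
rewrite /pairing -[in RHS](trmxK (v *m b *m u^T)) [RHS]mxE.
by rewrite !trmx_mul !trmxK mulmxA.
Qed.

(** Linearity is an explicit equation, so that multilinear expressions can be compared on coordinate
    vectors one argument at a time. *)
Lemma linear_delta_eq (h h' : 'rV[R]_n -> R) :
  (forall a u v, h (a *: u + v) = a * h u + h v) ->
  (forall a u v, h' (a *: u + v) = a * h' u + h' v) ->
  (forall i, h (delta_mx 0 i) = h' (delta_mx 0 i)) -> h =1 h'.
Proof.
move=> hl hl' hh u.
have z (k : 'rV[R]_n -> R) : (forall a u v, k (a *: u + v) = a * k u + k v) -> k 0 = 0.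
  by move=> kl; have := kl (-1) 0 0; rewrite scaler0 addr0; lra.
rewrite (row_sum_delta u); elim/big_ind : _ => [|x y ex ey|i _].
- by rewrite !z.
- by rewrite -[x]scale1r hl hl' !mul1r ex ey.
- by rewrite -[_ *: _]addr0 hl hl' hh !z.
Qed.

Lemma pairing_ext b b' : (forall u v, pairing b u v = pairing b' u v) -> b = b'.
Proof. by move=> bb'; apply/matrixP => i j; rewrite -!pairing_delta. Qed.

Lemma bilinear_pairing (s : 'rV[R]_n -> 'rV[R]_n -> R) :
  (forall a u u' v, s (a *: u + u') v = a * s u v + s u' v) ->
  (forall a u v v', s u (a *: v + v') = a * s u v + s u v') ->
  exists S, forall u v, s u v = pairing S u v.
Proof.
move=> sl sr; exists (\matrix_(i, j) s (delta_mx 0 i) (delta_mx 0 j)) => u v.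
move: u; apply: linear_delta_eq => [//|a u u'|i]; first by rewrite pairingDl pairingZl.
move: v; apply: linear_delta_eq => [//|a u u'|j]; first by rewrite pairingDr pairingZr.
by rewrite pairing_delta mxE.
Qed.

(** Orthonormality gives [invmx G = E^T *m E], and the trace is cyclic. The right-hand side does not
    involve [E], so any two orthonormal frames give the same sum. *)
Lemma orthonormal_trace G (S E : 'M[R]_n) : E *m G *m E^T = 1%:M ->
  \sum_j pairing S (row j E) (row j E) = \tr (S *m invmx G).
Proof.
move=> EG.
have GE : G *m (E^T *m E) = 1%:M by rewrite mulmxA; apply: mulmx1C; rewrite mulmxA.
have Gu : G \in unitmx by case/mulmx1_unit : GE.
have -> : invmx G = E^T *m E by rewrite -[RHS](mulKmx Gu) GE mulmx1.
rewrite mulmxA mxtrace_mulC mulmxA; apply: eq_bigr => j _.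
by rewrite /pairing -row_mul !mxE; apply: eq_bigr => k _; rewrite !mxE.
Qed.

End pairing_theory.

(** The difference [xi] of [z] and its orthogonal projection to the row space of [D] is normal,
    hence orthogonal to [z] and to the projection, hence to itself. *)
Lemma orthogonal_row_space (R : realType) (k n : nat) (G : 'M[R]_n) (D : 'M[R]_(k, n))
    (z : 'rV[R]_n) :
  (forall v, v != 0 -> 0 < pairing G v v) ->
  D *m G *m D^T \in unitmx ->
  (forall xi : 'rV[R]_n, D *m G *m xi^T = 0 -> xi *m G *m D^T = 0 -> pairing G z xi = 0) ->
  G^T = G ->
  exists t, z = t *m D.
Proof.
move=> Gpos Hu zn Gs; set H := D *m G *m D^T in Hu.
(* [t] solves the normal equations with Gram matrix [H]. *)
pose t := z *m G *m D^T *m invmx H; exists t; pose xi := z - t *m D.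
have n1 : xi *m G *m D^T = 0.
  have -> : xi *m G *m D^T = z *m G *m D^T - t *m H.
    by rewrite !mulmxBl /H !mulmxA.
  by rewrite /t mulmxKV// subrr.
have n2 : D *m G *m xi^T = 0.
  by apply: trmx_inj; rewrite !trmx_mul trmxK Gs mulmxA n1 trmx0.
apply/eqP; rewrite -subr_eq0 -/xi; apply: contraT => /Gpos.
rewrite {1}/xi pairingBl zn// /pairing -!mulmxA (mulmxA D) n2 !mulmx0 mxE.
by rewrite subrr ltxx.
Qed.

(* [P u], [Q u] and [Gam] stand for the derivatives of the metric and of the
   complex structure along [u], and the Christoffel symbols.  With
   Omega(a, b) = G(a, bJ), the left-hand side is dOmega(v, vJ, xi). *)
Lemma fundamental_form_identity (R : realType) (n : nat) (G J : 'M[R]_n)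
    (P Q : 'rV[R]_n -> 'M[R]_n) (Gam : 'rV[R]_n -> 'rV[R]_n -> 'rV[R]_n)
    (v xi : 'rV[R]_n) :
  (forall a b, pairing G a b = pairing G b a) ->
  J *m J = - 1%:M ->
  (forall a b, pairing G (a *m J) (b *m J) = pairing G a b) ->
  (forall u, Q u *m J + J *m Q u = 0) ->
  (forall u a b, pairing (P u) a b = pairing G (a *m Q u) (b *m J)
     + pairing (P u) (a *m J) (b *m J) + pairing G (a *m J) (b *m Q u)) ->
  (forall u a b, pairing (P u) a b = pairing G (Gam u a) b + pairing G a (Gam u b)) ->
  (forall u a, Gam u a = Gam a u) ->
  let dom u a b := pairing (P u) a (b *m J) + pairing G a (b *m Q u) in
  let v' := v *m J in
  dom v v' xi + dom v' xi v + dom xi v v' =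
  pairing G (v *m Q v' + v *m Q v *m J + Gam v v + Gam v' v') xi.
Proof.
move=> Gs JJ GJ QJ HP HG Gams dom v'; rewrite /dom.
have v'J : v' *m J = - v by rewrite /v' -mulmxA JJ mulmxN mulmx1.
have GJl a b : pairing G a (b *m J) = - pairing G (a *m J) b.
  by rewrite -GJ -[b *m J *m J]mulmxA JJ mulmxN mulmx1 pairingNr.
have v'Q : v' *m Q xi = - (v *m Q xi *m J).
  by rewrite /v' -!mulmxA; apply/eqP; rewrite -addr_eq0 -mulmxDr addrC QJ mulmx0.
(* [e1] rewrites the first [dom]. By [e2], [g2] and [g4], the terms differentiated along [xi] amount
   to minus the products of [v] with [Gam v xi] and of [v'] with [Gam v' xi], which cancel those
   produced by [g1] and [g3]. *)
have e1 := HP v v xi; have e2 := HP xi v v.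
have g1 := HG v v xi; have g2 := HG xi v v.
have g3 := HG v' v' xi; have g4 := HG xi v' v'.
rewrite -/v' in e1 e2.
rewrite v'J v'Q !pairingNr.
rewrite GJl in e1.
rewrite (Gams xi v) in g2; rewrite (Gams xi v') in g4.
rewrite (GJl v) -/v' !pairingDl.
have s1 := Gs v (Gam v xi); have s2 := Gs v' (Gam v' xi).
have s3 := Gs v' (v *m Q xi); have s4 := Gs xi (v *m Q v').
have s5 : pairing (P v') xi v' = pairing (P v') v' xi.
  by rewrite !HG addrC Gs [in RHS]Gs; congr (_ + _); apply: Gs.
by lra.
Qed.

(** * Smooth maps in coordinates and their second derivatives *)

Section smooth_on_theory.
Context (R : realType) (n : nat).

Lemma smooth_on_differentiable (V : normedModType R) (U : set 'rV[R]_n)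
    (f : 'rV[R]_n -> V) x : smooth_on U f -> U x -> differentiable f x.
Proof. by move=> /(_ 1%N)[+ _]; exact. Qed.

Lemma smooth_on_partial (V : normedModType R) (U : set 'rV[R]_n)
    (f : 'rV[R]_n -> V) i : smooth_on U f -> smooth_on U (partial i f).
Proof. by move=> fU k; have [_] := fU k.+1; exact. Qed.

Lemma smooth_on_cst (V : normedModType R) (U : set 'rV[R]_n) (v : V) :
  smooth_on U (cst v).
Proof.
move=> k; elim: k v => [|k IH] v /=; first by move=> x _; exact: cst_continuous.
split=> // i.
by rewrite (_ : partial i _ = cst 0)//; apply/funext => x; exact: derive_cst.
Qed.

Lemma differentiable_deriveP (V : normedModType R) (f : 'rV[R]_n -> V) x :
  differentiable f x ->
  forall a u v, 'D_(a *: u + v) f x = a *: 'D_u f x + 'D_v f x.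
Proof. by move=> df a u v; rewrite !deriveE// linearP. Qed.

End smooth_on_theory.

(* Locked, since unification between unfolded derivatives diverges. *)
HB.lock Definition hessian (R : realType) (k n : nat)
    (F : 'rV[R]_k -> 'rV[R]_n) (y u : 'rV[R]_k) : 'M[R]_(k, n) :=
  \matrix_(i, j) 'D_u (fun z => partial i F z 0 j : R^o) y.

Section hessian.
Context (R : realType) (k n : nat).
Implicit Types (F : 'rV[R]_k -> 'rV[R]_n) (U : set 'rV[R]_k) (u v : 'rV[R]_k).

Lemma hessianE F y u i j :
  hessian F y u i j = 'D_u (fun z => partial i F z 0 j : R^o) y.
Proof. by rewrite hessian.unlock mxE. Qed.

Lemma differentiable_partial U F y i j : smooth_on U F -> U y ->
  differentiable (fun z => partial i F z 0 j : R^o) y.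
Proof.
move=> sF Uy; apply: (differentiable_comp _ (differentiable_coord _ 0 j)).
exact: smooth_on_differentiable (smooth_on_partial i sF) Uy.
Qed.

(** The rows of the Jacobian are the partial derivatives wherever [F] is differentiable, hence near
    [y] because [U] is open. *)
Lemma is_derive_jacobian U F y u : open U -> smooth_on U F -> U y ->
  is_derive y u (fun z => 'J F z) (hessian F y u).
Proof.
move=> oU sF Uy.
apply: (@near_eq_is_derive _ _ _ (fun z => \matrix_i partial i F z)).
  near=> z; have /(smooth_on_differentiable sF) dF : U z.
    by near: z; exact: open_nbhs_nbhs.
  by apply/row_matrixP => i; rewrite rowK /partial deriveEjacobian// rowE.
apply/is_derive_mxP => i j; rewrite hessianE; under eq_fun do rewrite mxE.
exact: (derivableP (diff_derivable (differentiable_partial i j sF Uy))).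
Unshelve. all: by end_near. Qed.

Lemma hessianP U F y : smooth_on U F -> U y ->
  forall a u v, hessian F y (a *: u + v) = a *: hessian F y u + hessian F y v.
Proof.
move=> sF Uy a u v; apply/matrixP => i j.
have lin_mxE (A B : 'M[R]_(k, n)) : (a *: A + B) i j = a * A i j + B i j.
  by rewrite !mxE.
have dl := differentiable_deriveP (differentiable_partial i j sF Uy) a u v.
apply: etrans (hessianE _ _ _ _ _) (etrans dl _); apply: etrans (esym (lin_mxE _ _)).
by congr (a * _ + _); exact: esym (hessianE _ _ _ _ _).
Qed.

Lemma hessian_sym U F y : open U -> smooth_on U F -> U y ->
  forall u v, u *m hessian F y v = v *m hessian F y u.
Proof.
move=> oU sF Uy u v; apply/rowP => j.
(* [g u] is the derivative of the [j]-th component along [u], written through partial derivatives to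
   make its differentiability visible. *)
pose g u z : R^o := \sum_i u 0 i * partial i F z 0 j.
have fg (w : 'rV[R]_k) : \forall z \near y, is_derive z w (fun z => F z 0 j : R^o) (g w z).
  near=> z; have /(smooth_on_differentiable sF) dF : U z.
    by near: z; exact: open_nbhs_nbhs.
  have /is_derive_mxP/(_ 0 j) := derivableP (diff_derivable (v := w) dF).
  congr (is_derive _ _ _ _); rewrite deriveEjacobian// mxE; apply: eq_bigr => i _.
  by rewrite /partial deriveEjacobian// -rowE [in RHS]mxE.
have dp i := differentiable_partial i j sF Uy.
have gE w : g w = \sum_i (w 0 i *: (fun z => partial i F z 0 j : R^o)).
  by apply/funext => z; rewrite fct_sumE.
have dg w : differentiable (g w) y.
  by rewrite gE; apply: differentiable_sum => i; exact: differentiableZ.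
have eg w w' : 'D_w' (g w) y = (w *m hessian F y w') 0 j.
  rewrite gE derive_sum; last by move=> i; exact/derivableZ/diff_derivable.
  rewrite mxE; apply: eq_bigr => i _; rewrite deriveZ; last exact/diff_derivable.
  by rewrite hessianE.
rewrite -(eg u v) -(eg v u).
exact: (derive_comm (fg u) (dg u) (fg v) (dg v)).
Unshelve. all: by end_near. Qed.

End hessian.

(** * Images of charts *)

Section charts.
Context (R : realType).

Lemma open_cimage (n : nat) (M : manifold R n) (c : Defs.index M) (W : set M) :
  open W -> open (cimage c W).
Proof.
move=> oW; rewrite openE => _ [p [cp Wp] <-].
have cpp : (Defs.coord (atlas c) @` dom (atlas c)) (Defs.coord (atlas c) p) by exists p.
have : nbhs (Defs.coord (atlas c) p) (Defs.coord (atlas c) @` dom (atlas c)).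
  by apply: open_nbhs_nbhs; split=> //; exact: image_open.
have : nbhs (Defs.coord (atlas c) p) (param (atlas c) @^-1` W).
  apply: (param_continuous cpp); rewrite coordK//.
  exact: open_nbhs_nbhs.
apply: filterS2 => z /= Wz [q cq qz]; exists q => //; split=> //.
by rewrite -(coordK cq) qz.
Qed.

Lemma cimageT (n : nat) (M : manifold R n) (c : Defs.index M) p :
  dom (atlas c) p -> cimage c setT (Defs.coord (atlas c) p).
Proof. by move=> cp; exists p. Qed.

Lemma local_expr_cimage (k n : nat) (K : manifold R k) (M : manifold R n)
    (phi : K -> M) a c y : local_dom phi a c y ->
  cimage a setT y /\ cimage c setT (local_expr phi a c y).
Proof.
move=> [p [ap cp] <-]; split; first exact: cimageT.
by rewrite /local_expr/= coordK//; exact: cimageT.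
Qed.

Lemma open_local_dom (k n : nat) (K : manifold R k) (M : manifold R n)
    (phi : K -> M) a c : continuous phi -> open (local_dom phi a c).
Proof.
move=> phic; apply: open_cimage; apply: open_comp (dom_open _) => x _.
exact: phic.
Qed.

End charts.

Lemma is_derive_unique (R : numFieldType) (V W : normedModType R) (f : V -> W) x v d d' :
  is_derive x v f d -> is_derive x v f d' -> d = d'.
Proof. by move=> [_ <-] [_ <-]. Qed.

Lemma is_derive_pairing (R : realType) (V : normedModType R) n
    (b : V -> 'M[R]_n) (x u : V) db (v w : 'rV[R]_n) :
  is_derive x u b db ->
  is_derive x u (fun y => pairing (b y) v w : R^o) (pairing db v w).
Proof.
move=> bd.
have := is_derive_mulmx (is_derive_mulmx (is_derive_cst v x u) bd) (is_derive_cst w^T x u).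
move/is_derive_mxP => /(_ 0 0); rewrite mul0mx add0r mulmx0 addr0; exact.
Qed.

(** * Christoffel symbols of the Levi-Civita connection *)

Section christoffel_theory.
Context (R : realType) (n : nat) (M : manifold R n).
Implicit Types (g : components M 'M[R]_n) (G : christoffel M) (c : Defs.index M).
Implicit Types (x u v w : 'rV[R]_n).

Lemma christoffel_termPl G c x a u u' v :
  christoffel_term G c x (a *: u + u') v =
  a *: christoffel_term G c x u v + christoffel_term G c x u' v.
Proof.
rewrite /christoffel_term scaler_sumr -big_split; apply: eq_bigr => i _ /=.
rewrite scaler_sumr -big_split; apply: eq_bigr => j _ /=.
by rewrite scalerA -scalerDl !mxE mulrDl mulrA.
Qed.

Lemma christoffel_termPr G c x a u v v' :
  christoffel_term G c x u (a *: v + v') =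
  a *: christoffel_term G c x u v + christoffel_term G c x u v'.
Proof.
rewrite /christoffel_term scaler_sumr -big_split; apply: eq_bigr => i _ /=.
rewrite scaler_sumr -big_split; apply: eq_bigr => j _ /=.
by rewrite scalerA -scalerDl !mxE mulrDr mulrCA.
Qed.

Lemma nabla_cst G c u v x :
  nabla G c (cst u) (cst v) x = christoffel_term G c x u v.
Proof. by rewrite /nabla derive_cst add0r. Qed.

(** Fields that are constant in a chart have zero bracket; torsion-freeness is applied to them. *)
Lemma levi_civita_sym g G c x u v : levi_civita g G -> cimage c setT x ->
  christoffel_term G c x u v = christoffel_term G c x v u.
Proof.
move=> [_ torsion _] cx.
have := torsion c _ _ (smooth_on_cst _ u) (smooth_on_cst _ v) x cx.
rewrite !nabla_cst /lie_bracket !derive_cst subrr => /eqP.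
by rewrite subr_eq0 => /eqP.
Qed.

(** For constant fields, the derivative of their product falls on the matrix of the metric alone. *)
Lemma levi_civita_metric g G c x u v w dg : levi_civita g G -> cimage c setT x ->
  is_derive x u (g c) dg ->
  pairing dg v w = pairing (g c x) (christoffel_term G c x u v) w
                 + pairing (g c x) v (christoffel_term G c x u w).
Proof.
move=> [_ _ metric] cx dgx.
have := metric c _ _ _ (smooth_on_cst _ u) (smooth_on_cst _ v)
  (smooth_on_cst _ w) x cx.
rewrite !nabla_cst /= => <-.
by have [_ <-] := is_derive_pairing v w dgx.
Qed.

End christoffel_theory.

(** Both sides are trilinear, so it is enough to compare them on coordinate vectors. [W u] stands
    for the derivative of a 2-form along [u]. *)
Lemma cyclic_wedge_ext (R : realType) (n : nat) (W : 'rV[R]_n -> 'M[R]_n)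
    (l : 'rV[R]_n) (b : 'M[R]_n) :
  (forall a u v, W (a *: u + v) = a *: W u + W v) ->
  (forall i j k, W (delta_mx 0 i) j k + W (delta_mx 0 j) k i + W (delta_mx 0 k) i j
     = wedge12 l b i j k) ->
  forall u v w, pairing (W u) v w + pairing (W v) w u + pairing (W w) u v =
    (u *m l^T) 0 0 * pairing b v w + (v *m l^T) 0 0 * pairing b w u
    + (w *m l^T) 0 0 * pairing b u v.
Proof.
move=> Wl We.
have pW a u u' v w :
    pairing (W (a *: u + u')) v w = a * pairing (W u) v w + pairing (W u') v w.
  by rewrite Wl /pairing mulmxDr mulmxDl -scalemxAr -scalemxAl !mxE.
have ll a u u' : ((a *: u + u') *m l^T) 0 0 = a * (u *m l^T) 0 0 + (u' *m l^T) 0 0.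
  by rewrite mulmxDl -scalemxAl !mxE.
have le i : ((delta_mx 0 i : 'rV_n) *m l^T) 0 0 = l 0 i by rewrite -rowE !mxE.
have lin := (pW, ll, pairingDl, pairingDr, pairingZl, pairingZr).
move=> u v w; move: u; apply: linear_delta_eq => [a u u'|a u u'|i].
- by rewrite !lin; ring.
- by rewrite !lin; ring.
move: v; apply: linear_delta_eq => [a u u'|a u u'|j].
- by rewrite !lin; ring.
- by rewrite !lin; ring.
move: w; apply: linear_delta_eq => [a u u'|a u u'|k].
- by rewrite !lin; ring.
- by rewrite !lin; ring.
by rewrite !pairing_delta We !le.
Qed.

(** * Derivatives of the Hermitian identities at a point *)

Section hermitian_at.
Context (R : realType) (n : nat) (M : manifold R n) (J g : components M 'M[R]_n).
Hypotheses (aJ : almost_complex J) (hg : hermitian_metric_on setT J g).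
Context (c : Defs.index M) (x : 'rV[R]_n) (cx : cimage c setT x).
(** The image of a chart is open, so an identity valid on it may be differentiated at [x]. *)
Let nearT (P : set 'rV[R]_n) : (forall z, cimage c setT z -> P z) -> \forall z \near x, P z.
Proof.
by move=> PT; apply: filterS PT _; apply: open_nbhs_nbhs; split=> //; exact/open_cimage/openT.
Qed.

Lemma is_derive_complex_structure u : is_derive x u (J c) ('D_u (J c) x).
Proof. by apply/derivableP/diff_derivable/smooth_on_differentiable/cx; case: aJ => -[]. Qed.

Lemma is_derive_metric u : is_derive x u (g c) ('D_u (g c) x).
Proof. by apply/derivableP/diff_derivable/smooth_on_differentiable/cx; case: hg => -[[]]. Qed.

Lemma derive_complex_structure_anticomm u :
  'D_u (J c) x *m J c x + J c x *m 'D_u (J c) x = 0.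
Proof.
have dJ := is_derive_complex_structure u.
apply: is_derive_unique (is_derive_mulmx dJ dJ) _.
apply: near_eq_is_derive (is_derive_cst (- 1%:M) x u).
by apply: nearT => z cz; case: aJ => _ ->.
Qed.

Lemma hermitian_metric_mx z : cimage c setT z -> J c z *m g c z *m (J c z)^T = g c z.
Proof.
move=> cz; apply: pairing_ext => u v; case: hg => _ <-//.
by rewrite /pairing trmx_mul !mulmxA.
Qed.

(** Product rule for [J *m g *m J^T = g]. *)
Lemma derive_hermitian_metric u a b :
  pairing ('D_u (g c) x) a b =
    pairing (g c x) (a *m 'D_u (J c) x) (b *m J c x)
    + pairing ('D_u (g c) x) (a *m J c x) (b *m J c x)
    + pairing (g c x) (a *m J c x) (b *m 'D_u (J c) x).
Proof.
have dJ := is_derive_complex_structure u; have dg := is_derive_metric u.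
have := is_derive_mulmx (is_derive_mulmx dJ dg) (is_derive_trmx dJ).
move=> /(near_eq_is_derive (nearT hermitian_metric_mx))/(is_derive_unique dg).
move: ('D_u (g c) x) ('D_u (J c) x) => P Q {1}->.
by rewrite /pairing !mulmxDl !mulmxDr !mulmxDl !trmx_mul !mulmxA !mxE.
Qed.

Lemma is_derive_fundamental_form u :
  is_derive x u (fundamental_form J g c)
    ('D_u (g c) x *m (J c x)^T + g c x *m ('D_u (J c) x)^T).
Proof.
exact: is_derive_mulmx (is_derive_metric u) (is_derive_trmx (is_derive_complex_structure u)).
Qed.

End hermitian_at.

(** * Second derivatives of a complex submanifold and the Lee form *)

Section submanifold_at.
Context (R : realType) (k n : nat) (K : manifold R k) (M : manifold R n).
Context (J g : components M 'M[R]_n) (w : components M 'rV[R]_n).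
Context (JK : components K 'M[R]_k) (phi : K -> M) (GM : christoffel M).
Hypotheses (aJ : almost_complex J) (hg : hermitian_metric_on setT J g).
Hypotheses (lw : lee_form J g w) (lGM : levi_civita g GM).
Hypotheses (aJK : almost_complex JK) (sphi : submanifold phi).
Hypothesis (hphi : holomorphic JK J phi).
Context (a : Defs.index K) (c : Defs.index M) (y : 'rV[R]_k).
Hypothesis (ly : local_dom phi a c y).

Let F := local_expr phi a c.
Let x := F y.
Let D := 'J F y.
Let oU : open (local_dom phi a c).
Proof. by case: sphi => -[phic _] _ _; exact: open_local_dom. Qed.
Let sF : smooth_on (local_dom phi a c) F.
Proof. by case: sphi => -[_ +] _ _; exact. Qed.
Let ay : cimage a setT y. Proof. by case: (local_expr_cimage ly). Qed.
Let cx : cimage c setT x. Proof. by case: (local_expr_cimage ly). Qed.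

Lemma metric_sym u v : pairing (g c x) u v = pairing (g c x) v u.
Proof. by case: hg => -[_ gp] _; have [+ _] := gp c x cx; exact. Qed.

Lemma complex_structure_sqr : J c x *m J c x = - 1%:M.
Proof. by case: aJ => _; exact. Qed.

Lemma fundamental_form_pairing u v :
  pairing (fundamental_form J g c x) u v = pairing (g c x) u (v *m J c x).
Proof. by rewrite /pairing /fundamental_form trmx_mul !mulmxA. Qed.

(** This is dOmega = w /\ Omega on arbitrary vectors, with the derivative of Omega expanded by the
    product rule. *)
Lemma lee_form_pairing u v z :
  let dom u v z := pairing ('D_u (g c) x) v (z *m J c x)
                   + pairing (g c x) v (z *m 'D_u (J c) x) in
  dom u v z + dom v z u + dom z u v =
  (u *m (w c x)^T) 0 0 * pairing (g c x) v (z *m J c x)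
  + (v *m (w c x)^T) 0 0 * pairing (g c x) z (u *m J c x)
  + (z *m (w c x)^T) 0 0 * pairing (g c x) u (v *m J c x).
Proof.
case: lw => _ _ lwx dom.
pose W u := 'D_u (g c) x *m (J c x)^T + g c x *m ('D_u (J c) x)^T.
have domE u' v' z' : dom u' v' z' = pairing (W u') v' z'.
  rewrite /dom /W; move: ('D_u' (g c) x) ('D_u' (J c) x) => P Q.
  by rewrite /pairing mulmxDr mulmxDl [RHS]mxE !trmx_mul !mulmxA.
rewrite !domE -!fundamental_form_pairing; apply: cyclic_wedge_ext => [b u' v'|i j l].
  have dg : differentiable (g c) x.
    by apply/smooth_on_differentiable/cx; case: hg => -[[]].
  have dJ : differentiable (J c) x.
    by apply/smooth_on_differentiable/cx; case: aJ => -[].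
  rewrite /W !differentiable_deriveP//.
  move: ('D_u' _ _) ('D_u' _ _) ('D_v' _ _) ('D_v' _ _) => P Q P' Q'.
  rewrite linearP/= mulmxDl mulmxDr -!scalemxAl -!scalemxAr scalerDr.
  by rewrite addrACA.
rewrite -(lwx c x cx) /dext2 /partial.
have dOmega u' i' j' :
    'D_u' (fun z => fundamental_form J g c z i' j' : R^o) x = W u' i' j'.
  by have /is_derive_mxP/(_ i' j')[_ ->] := is_derive_fundamental_form aJ hg cx u'.
by rewrite !dOmega.
Qed.

(** Differentiates the complex linearity of the differential of [phi] along [u]; by the chain rule
    [J] is differentiated along the image [u *m D]. *)
Lemma derive_holomorphic u :
  'D_u (JK a) y *m D + JK a y *m hessian F y u =
  hessian F y u *m J c x + D *m 'D_(u *m D) (J c) x.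
Proof.
have dF : differentiable F y by exact: smooth_on_differentiable sF ly.
have dJ : differentiable (J c) x.
  by apply/smooth_on_differentiable/cx; case: aJ => -[].
have dJF : is_derive y u (J c \o F) ('D_(u *m D) (J c) x).
  split; first exact/diff_derivable/differentiable_comp.
  rewrite deriveE; last exact: differentiable_comp.
  by rewrite diff_comp//= deriveE// -deriveEjacobian// deriveE.
have dDF := is_derive_jacobian u oU sF ly.
have dJK : is_derive y u (JK a) ('D_u (JK a) y).
  exact: (is_derive_complex_structure aJK ay u).
apply: is_derive_unique (is_derive_mulmx dJK dDF) _.
apply: near_eq_is_derive (is_derive_mulmx dDF dJF).
by apply: filterS (open_nbhs_nbhs (conj oU ly)) => z /hphi.
Qed.

(** Coordinate form of the tangency of [X, JX]. Complex linearity is differentiated along [u] and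
    [u *m JK a y], both results are applied to [u], and the mixed second derivative is eliminated by
    the symmetry of the Hessian. *)
Lemma hessian_complex u : let v := u *m D in
  exists t, u *m hessian F y u + u *m JK a y *m hessian F y (u *m JK a y) =
  v *m 'D_v (J c) x *m J c x + v *m 'D_(v *m J c x) (J c) x + t *m D.
Proof.
move=> v; set u' := u *m JK a y.
have hol : JK a y *m D = D *m J c x by exact: hphi.
have u'D : u' *m D = v *m J c x by rewrite /u' -mulmxA hol mulmxA.
have := congr1 (mulmx u) (derive_holomorphic u).
have := congr1 (mulmx u) (derive_holomorphic u').
have := hessian_sym oU sF ly u u'.
rewrite u'D -/v; move: (hessian F y u) (hessian F y u') => H H'.
move: ('D_u _ _) ('D_u' _ _) ('D_v _ _) ('D__ (J c) _) => A A' Q Q'.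
rewrite !mulmxDr !mulmxA -/u' -/v => e3 e2 e1.
(* The derivatives [A] and [A'] of [JK] contribute only tangent vectors, collected here. *)
exists (- (u *m A *m JK a y + u *m A')).
rewrite mulNmx mulmxDl -[u *m A *m _ *m _]mulmxA hol.
have -> : u' *m H' = v *m Q' + u *m H' *m J c x - u *m A' *m D.
  by rewrite [v *m Q' + _]addrC -e2 addrAC subrr add0r.
rewrite e3; have -> : u' *m H = u *m H *m J c x + v *m Q - u *m A *m D.
  by rewrite -e1 addrAC subrr add0r.
rewrite mulmxBl mulmxDl -[u *m H *m _ *m _]mulmxA complex_structure_sqr.
rewrite mulmxN mulmx1 !mulmxA opprD !addrA.
by rewrite [_ + _ - u *m H]addrAC subrr add0r [v *m Q' + _]addrC.
Qed.

(** [S u] is the covariant derivative along [phi], in the direction [u], of the field with constant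
    components [u]. Up to tangent vectors, [hessian_complex] turns the sum into the vector of
    [fundamental_form_identity], whose product with [xi] is dOmega(v, Jv, xi). *)
Lemma mean_curvature_pair u xi :
  let S u := u *m hessian F y u + christoffel_term GM c x (u *m D) (u *m D) in
  D *m g c x *m xi^T = 0 ->
  pairing (g c x) (S u + S (u *m JK a y)) xi =
  - pairing (g c x) (u *m D) (u *m D) * (xi *m (w c x)^T) 0 0.
Proof.
move=> S nxi; set u' := u *m JK a y; set v := u *m D.
have hol : JK a y *m D = D *m J c x by exact: hphi.
have u'D : u' *m D = v *m J c x by rewrite /u' -mulmxA hol mulmxA.
have nD r : pairing (g c x) (r *m D) xi = 0.
  by rewrite /pairing -!mulmxA (mulmxA D) nxi mulmx0 mxE.
have [t ht] := hessian_complex u; rewrite -/u' -/v in ht.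
rewrite /S u'D -/v addrACA ht.
have GJ b d : pairing (g c x) (b *m J c x) (d *m J c x) = pairing (g c x) b d.
  by case: hg => _; exact.
have dg z := is_derive_metric hg cx z.
have := fundamental_form_identity v xi metric_sym complex_structure_sqr GJ
  (derive_complex_structure_anticomm aJ cx) (derive_hermitian_metric aJ hg cx)
  (fun z b d => levi_civita_metric b d lGM cx (dg z))
  (fun z b => levi_civita_sym z b lGM cx).
have := lee_form_pairing v (v *m J c x) xi.
move=> /= -> e.
rewrite addrAC pairingDl nD addr0 [v *m _ *m _ + _]addrC addrA -e.
(* Two of the three terms of w /\ Omega vanish, since [v] and [v *m J c x] are tangent and [xi] is
   normal; J^2 = -1 gives the sign of the third. *)
rewrite GJ [pairing _ v xi]nD mulr0 add0r.
rewrite (metric_sym xi) -u'D nD mulr0 add0r.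
by rewrite u'D -mulmxA complex_structure_sqr mulmxN mulmx1 pairingNr mulrC.
Qed.

End submanifold_at.

(** * Trace over an orthonormal frame *)

Theorem theorem2p13 (R : realType) (n m : nat)
    (M : manifold R n.*2) (J g : components M 'M[R]_(n.*2))
    (w B : components M 'rV[R]_(n.*2))
    (K : manifold R m.*2) (JK : components K 'M[R]_(m.*2)) (phi : K -> M) :
  lck_manifold J g ->
  lee_form J g w ->
  sharp_of g w B ->
  complex_submanifold JK J phi ->
  V_minimal phi g (fun c x => - m%:R *: B c x).
Proof.
move=> [[[aJ _] hg] _] lw [_ wB] [[aJK _] sphi hphi].
move=> gK GM GK igK lGM _ p W E oW Wp [vE oE] a c ap cp y trA.
have ly : local_dom phi a c y by exists p.
have Wy : cimage a W y by exists p.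
have [ay cx] := local_expr_cimage ly.
have xE : Defs.coord (atlas c) (phi p) = local_expr phi a c y.
  by rewrite /local_expr /y /= coordK.
rewrite xE; move: @trA; set F := local_expr phi a c; set x := F y; set D := 'J F y.
move=> trA.
have oU : open (local_dom phi a c).
  by case: sphi => -[phic _] _ _; exact: open_local_dom.
have sF : smooth_on (local_dom phi a c) F by case: sphi => -[_ +] _ _; exact.
have gKE : gK a y = D *m g c x *m D^T by exact: igK.
pose Em := \matrix_j E j a y.
pose S u := u *m hessian F y u + christoffel_term GM c x (u *m D) (u *m D).
(* The derivatives of the components of the frame and the connection of [K] contribute tangent
   vectors only, so [S] replaces the second fundamental form. *)
have [t0 trE] : exists t0, trA = \sum_j S (row j Em) + t0 *m D.
  exists (\sum_j ('D_(E j a y) (E j a) y - nabla GK a (E j a) (E j a) y)).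
  rewrite /trA mulmx_suml -big_split; apply: eq_bigr => j _ /=.
  rewrite /second_fundamental_form /nabla_along -/F -/D rowK /S mulmxBl.
  have dE : is_derive y (E j a y) (E j a) ('D_(E j a y) (E j a) y).
    by apply/derivableP/diff_derivable/smooth_on_differentiable/Wy; case: (vE j).
  have [_ ->] := is_derive_mulmx dE (is_derive_jacobian (E j a y) oU sF ly).
  by rewrite -[_ + christoffel_term _ _ _ _ _]addrA addrAC addrC.
have frame1 : Em *m gK a y *m Em^T = 1%:M.
  apply/matrixP => i j; rewrite [RHS]mxE -(oE a y Wy i j) /pairing.
  rewrite -[E i a y](rowK (fun j => E j a y)) -[E j a y](rowK (fun j => E j a y)).
  by rewrite -row_mul [in RHS]mxE [in LHS]mxE; apply: eq_bigr => l _; rewrite !mxE.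
(* The induced metric is invariant under [JK], as [g] is under [J] and the differential of [phi] is
   complex linear. *)
have frame2 : (Em *m JK a y) *m gK a y *m (Em *m JK a y)^T = 1%:M.
  rewrite -frame1 trmx_mul !mulmxA; congr (_ *m _); rewrite -!mulmxA; congr (_ *m _).
  have hol : JK a y *m D = D *m J c x by exact: hphi.
  rewrite gKE -[in RHS](hermitian_metric_mx hg cx) !mulmxA hol -!mulmxA.
  by rewrite -!trmx_mul hol.
have gKu : gK a y \in unitmx.
  by have [+ _] := mulmx1_unit frame1; rewrite unitmx_mul => /andP[].
have Gs u v : pairing (g c x) u v = pairing (g c x) v u.
  exact: (metric_sym hg ly).
(* Tangency is tested against normal vectors [xi]. *)
apply: (@orthogonal_row_space _ _ _ (g c x)).
- by move=> v; case: hg => -[_ gp] _; have [_ +] := gp c x cx; exact.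
- by rewrite -gKE.
- move=> xi nxi _.
  have nD r : pairing (g c x) (r *m D) xi = 0.
    by rewrite /pairing -!mulmxA (mulmxA D) nxi mulmx0 mxE.
  (* This bilinear form polarizes the quadratic map [S], so its trace is the same over the frames
     [Em] and [Em *m JK a y]. *)
  have [||Sm SmE] := @bilinear_pairing _ _ (fun u v => pairing (g c x)
      (u *m hessian F y v + christoffel_term GM c x (u *m D) (v *m D)) xi).
  + move=> b u u' v; rewrite !mulmxDl -!scalemxAl christoffel_termPl addrACA -scalerDr.
    by rewrite pairingDl pairingZl.
  + move=> b u v v'; rewrite (hessianP sF ly) mulmxDr -scalemxAr mulmxDl -scalemxAl.
    by rewrite christoffel_termPr addrACA -scalerDr pairingDl pairingZl.
  have tr2 : \sum_j pairing (g c x) (S (row j Em)) xi =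
      \sum_j pairing (g c x) (S (row j Em *m JK a y)) xi.
    under eq_bigr do rewrite SmE; under [RHS]eq_bigr do rewrite SmE -row_mul.
    by rewrite (orthonormal_trace _ frame1) (orthonormal_trace _ frame2).
  have trS : \sum_j pairing (g c x) (S (row j Em)) xi = - m%:R * (xi *m (w c x)^T) 0 0.
    (* Doubling the sum pairs each [e_j] with [J e_j]; each of the [m.*2] pairs contributes
       [- w(xi)], and the factor 2 cancels. *)
    have two0 : (2 : R) != 0 by rewrite pnatr_eq0.
    apply: (mulfI two0).
    rewrite [LHS]mulr_natl mulr2n [X in _ + X]tr2 -big_split/=.
    under eq_bigr => j _.
      rewrite -pairingDl (mean_curvature_pair aJ hg lw lGM aJK sphi hphi ly _ nxi).
      have -> : pairing (g c x) (row j Em *m D) (row j Em *m D) = 1.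
        apply: etrans (etrans (oE a y Wy j j) _); last by rewrite eqxx.
        by rewrite rowK gKE /pairing trmx_mul !mulmxA.
      over.
    rewrite sumr_const card_ord -/F -/x; move: ((xi *m _) 0 0) => r.
    by rewrite -[LHS]mulr_natr -muln2 natrM; ring.
  rewrite trE pairingBl pairingDl nD addr0 pairing_suml trS pairingZl Gs -wB//.
  by rewrite subrr.
- by apply: pairing_ext => u v; rewrite pairing_trmx.
Qed.
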